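(* Let $\mathcal{F}$ be a finite field of order $q$, and let $n\ge 2$ and $d_1,\ldots,d_n\ge 2$ be integers. Put $\tilde{d}=d_1d_2\cdots d_n$. If either (i) $n=2$, or (ii) $n\ge 3$ and $q>\max\{d_i : i\ne n_1,n_2\}$ for some indices $n_1,n_2\in\{1,\ldots,n\}$, then \[ \max\bigl\{\dim\mathcal{L} : \mathcal{L}\text{ is a subspace of }\mathcal{F}^{d_1}\otimes\cdots\otimes\mathcal{F}^{d_n}\text{ and has no product basis}\bigr\} = \tilde{d}-2. \]
   Context: A vector $u\in\mathcal{F}^{d_1}\otimes\cdots\otimes\mathcal{F}^{d_n}$ is called a product vector if $u=u^{[1]}\otimes\cdots\otimes u^{[n]}$ for some $u^{[1]}\in\mathcal{F}^{d_1},\ldots,u^{[n]}\in\mathcal{F}^{d_n}$. A product basis of a subspace $\mathcal{L}$ is a basis of $\mathcal{L}$ composed of product vectors. *)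

(* Defs.v *)
From HB Require Import structures.
From mathcomp Require Import all_boot all_order all_algebra all_field.

Set Implicit Arguments.
Unset Strict Implicit.
Unset Printing Implicit Defensive.

Import GRing.Theory.
Local Open Scope ring_scope.

Section Tensor.

Variables (F : fieldType) (n : nat) (d : 'I_n -> nat).

(* F^(d 0) (x) ... (x) F^(d (n - 1)) in coordinates: the function t stands for
   \sum_j t j *: (e_(j 0) (x) ... (x) e_(j (n - 1))), where j ranges over the
   multi-indices with j i < d i and the e_k are standard basis vectors. *)
Definition tensor_space : vectType F :=
  {ffun {dffun forall i : 'I_n, 'I_(d i)} -> F^o}.

Definition tensor (u : forall i : 'I_n, 'rV[F]_(d i)) : tensor_space :=
  [ffun j : {dffun forall i : 'I_n, 'I_(d i)} => \prod_(i < n) u i 0 (j i)].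

Definition product_vector (v : tensor_space) : Prop :=
  exists u : forall i : 'I_n, 'rV[F]_(d i), v = tensor u.

Definition has_product_basis (L : {vspace tensor_space}) : Prop :=
  exists2 X : seq tensor_space,
    basis_of L X & forall v : tensor_space, v \in X -> product_vector v.

End Tensor.

Definition is_max (S : nat -> Prop) (m : nat) : Prop :=
  S m /\ (forall k : nat, S k -> (k <= m)%N).

(* Main.v *)
Require Import Defs.
From HB Require Import structures.
From mathcomp Require Import all_boot all_order all_algebra all_field.

(* Upper bound: let [f] be a linear form with kernel L, of codimension at most 1.
   If L were not spanned by its product vectors, some linear form [g] would
   vanish on them but not on L.  On product vectors [f = 0] implies [g = 0]; both
   are multilinear there, and freeing one tensor factor at a time shows that [g]
   is proportional to [f], because a linear map sending every vector to a
   multiple of itself is a scalar.  Hence [g = 0] on L, a contradiction.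

   Lower bound: with the indices of all but the first two factors set to 0,
   take L = {t | t_10 = 0 and t_00 = t_11}.  A product vector satisfies
   t_00 t_11 = t_10 t_01, so in L it has t_00 = 0, which fails for some t in L. *)

Set Implicit Arguments.
Unset Strict Implicit.
Unset Printing Implicit Defensive.

Import GRing.Theory.
Local Open Scope ring_scope.

(** * Bases inside spanning lists, and linear forms *)

Lemma span_basis_subseq (K : fieldType) (V : vectType K) (X : seq V) :
  exists2 Y : seq V, basis_of <<X>> Y & {subset Y <= X}.
Proof.
elim: X => [|x X [Y YB YX]]; first by exists [::]; rewrite ?span_nil ?nil_basis.
case: (boolP (x \in <<X>>%VS)) => [xX|xNX].
  exists Y; last by move=> v /YX vX; rewrite inE vX orbT.
  by rewrite span_cons (addv_idPr _) // -memvE.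
exists (x :: Y); last first.
  by move=> v; rewrite !inE => /orP[->//|/YX ->]; rewrite orbT.
move: YB; rewrite !basisEdim /= => /andP[XY sY].
have freeY : free Y by apply: (@basis_free _ _ <<X>>%VS); rewrite basisEdim XY.
have eqXY : <<Y>>%VS = <<X>>%VS.
  by apply/span_basis; rewrite basisEdim XY.
rewrite -basisEdim basisEfree free_cons eqXY xNX freeY !span_cons eqXY subvv /=.
by rewrite -eqXY -span_cons dim_span.
Qed.

(** Some coordinate is nonzero at [v - projv W v]; composed with the projection [\1 - projv W], it
    kills [W] but not [v]. *)
Lemma separating_functional (K : fieldType) (V : vectType K) (W : {vspace V})
    (v : V) :
  v \notin W -> exists f : 'Hom(V, K^o), (W <= lker f)%VS /\ f v != 0.
Proof.
move=> vNW; have w_neq0 : v - projv W v != 0.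
  by apply: contra vNW; rewrite subr_eq0 => /eqP ->; apply: memv_proj.
have [i ci] : exists i, coord (vbasis {:V}) i (v - projv W v) != 0.
  apply/existsP; apply: contraR w_neq0 => /existsPn c0.
  rewrite (coord_vbasis (memvf (v - _))) big1 // => i _.
  by have /negPn/eqP -> := c0 i; rewrite scale0r.
exists (linfun (coord (vbasis {:V}) i : V -> K^o) \o (\1 - projv W))%VF; split.
  apply/subvP => w wW; rewrite memv_ker !lfun_simp /= projv_id // subrr.
  by rewrite linear0.
by rewrite !lfun_simp.
Qed.

(* The conclusion says that the families [A] and [B] are proportional, i.e.
   that [c] in [B t x = c * A t x], a priori depending on [x], does not. *)
Lemma pointwise_proportional (K : fieldType) (V : lmodType K) (T : Type)
    (A B : T -> {linear V -> K^o}) :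
    (forall t x, A t x = 0 -> B t x = 0) ->
    (forall x t t', B t x * A t' x = B t' x * A t x) ->
  forall t t' x x', B t x * A t' x' = B t' x' * A t x.
Proof.
move=> A0 BA t t' x y.
have [Ay|Ay] := eqVneq (A t' y) 0; first by rewrite Ay (A0 _ _ Ay) mulr0 mul0r.
(* Translating [x] along [y], we may assume [A t' x = 0]. *)
suff shifted z : A t' z = 0 -> B t z * A t' y = B t' y * A t z.
  pose a := A t' x / A t' y.
  have lin (h : {linear V -> K^o}) : h (x - a *: y) = h x - a * h y.
    by rewrite linearB linearZ.
  have := shifted (x - a *: y).
  rewrite !lin divfK // subrr => /(_ erefl).
  rewrite mulrBl mulrBr -mulrA BA mulrCA.
  exact: addIr.
(* Also [B t' z = 0], so subtracting [BA] at [y] from [BA] at [z + y] leaves the claim. *)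
move=> Az; have := BA (z + y) t t'.
by rewrite !linearD /= Az (A0 _ _ Az) !add0r mulrDl mulrDr BA => /addIr.
Qed.

(** * Multilinearity of the tensor product and proportionality of linear forms *)

Section Tensors.
Variables (F : fieldType) (n : nat) (d : 'I_n -> nat).
Implicit Types u v : forall i : 'I_n, 'rV[F]_(d i).

Lemma eq_tensor u v : (forall i, u i = v i) -> tensor u = tensor v.
Proof.
by move=> uv; apply/ffunP => j; rewrite !ffunE; apply: eq_bigr => i _; rewrite uv.
Qed.

Lemma tensor_linear u (i : 'I_n) :
  linear (fun x : 'rV[F]_(d i) => tensor (dfwith u x)).
Proof.
move=> a x y; apply/ffunP => j.
have E z : tensor (dfwith u z) j =
    z 0 (j i) * \prod_(k < n | k != i) u k 0 (j k).
  rewrite ffunE (bigD1 i) //= dfwith_in; congr (_ * _).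
  by apply: eq_bigr => k ki; rewrite dfwith_out // eq_sym.
by rewrite [RHS]ffunE [X in _ = X + _]ffunE !E !mxE mulrDl -mulrA.
Qed.

Definition tensor_at u (i : 'I_n) (x : 'rV[F]_(d i)) : tensor_space F d :=
  tensor (dfwith u x).

HB.instance Definition _ u i :=
  GRing.isLinear.Build F 'rV[F]_(d i) (tensor_space F d) *:%R (@tensor_at u i)
    (@tensor_linear u i).

Lemma tensor_at_id u i : tensor_at u (u i) = tensor u.
Proof. by apply: eq_tensor => j; case: dfwithP. Qed.

Implicit Types f g : {linear tensor_space F d -> F^o}.

Lemma tensor_proportional f g :
    (forall u, f (tensor u) = 0 -> g (tensor u) = 0) ->
  forall u v, g (tensor u) * f (tensor v) = g (tensor v) * f (tensor u).
Proof.
(* Induction on a list [s] of positions outside which the two families agree. *)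
move=> fg u v; pose agree (s : seq 'I_n) u v := forall j, j \notin s -> u j = v j.
suff prop s u' v' : agree s u' v' ->
    g (tensor u') * f (tensor v') = g (tensor v') * f (tensor u').
  by apply: (prop (enum 'I_n)) => j; rewrite mem_enum.
elim: s u' v' => [|i s IHs] u' v' uv'.
  by rewrite (@eq_tensor u' v') // => j; apply: uv'.
(* In [pointwise_proportional] the vector is the factor at [i] and the parameter in [T] supplies the
   other factors. Two members of [T] given the same factor at [i] agree outside [s], so [IHs]
   applies to them. *)
pose T := {w | agree (i :: s) u' w}.
pose A (h : {linear tensor_space F d -> F^o}) (w : T) :
    {linear 'rV[F]_(d i) -> F^o} :=
  h \o @tensor_at (sval w) i.
have := @pointwise_proportional F _ T (A f) (A g) _ _
  (exist _ u' (fun j _ => erefl)) (exist _ v' uv') (u' i) (v' i).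
rewrite /= !tensor_at_id; apply.
  by move=> w x; apply: fg.
move=> x [w uw] [w' uw']; apply: IHs => j /= js.
case: dfwithP js => [|k ik] ks; first by rewrite dfwith_in.
by rewrite dfwith_out // -uw ?uw' // inE negb_or eq_sym ik.
Qed.

Definition unit_tensor (j : {dffun forall i : 'I_n, 'I_(d i)}) :=
  tensor (fun i => delta_mx 0 (j i) : 'rV[F]_(d i)).

Lemma tensor_decomposition (t : tensor_space F d) :
  t = \sum_j t j *: unit_tensor j.
Proof.
have unitE j k : unit_tensor j k = (k == j)%:R.
  rewrite ffunE; have [->|/eqP jk] := eqVneq k j.
    by apply: big1 => i _; rewrite mxE !eqxx.
  have [i ji] : exists i, k i != j i.
    apply/existsP; apply: contra_notT jk => /existsPn kj.
    by apply/ffunP => i; apply/eqP/negPn.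
  by rewrite (bigD1 i) //= mxE (negPf ji) andbF mul0r.
apply/ffunP => k; rewrite sum_ffunE (bigD1 k) //= big1 => [|j jk].
  by rewrite addr0 ffunE unitE eqxx /GRing.scale /= mulr1.
by rewrite ffunE unitE eq_sym (negPf jk) /GRing.scale /= mulr0.
Qed.

(** If [f] is nonzero at some unit tensor, expanding [t] in unit tensors carries the proportionality
    from product vectors to [t]. Otherwise [g] also kills every unit tensor. *)
Lemma functional_ker_sub f g :
    (forall u, f (tensor u) = 0 -> g (tensor u) = 0) ->
  forall t, f t = 0 -> g t = 0.
Proof.
move=> fg t ft; have [/existsP[k fk]|/existsPn f0] :=
    boolP [exists k, f (unit_tensor k) != 0].
  apply: (mulIf fk); rewrite mul0r -[RHS](mulr0 (g (unit_tensor k))) -ft.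
  rewrite (tensor_decomposition t) !linear_sum /= mulr_suml mulr_sumr.
  apply: eq_bigr => j _; rewrite !linearZ /= /GRing.scale /=.
  by rewrite -mulrA tensor_proportional // mulrCA.
rewrite (tensor_decomposition t) linear_sum big1 // => j _.
by rewrite linearZ /= fg ?scaler0 //; apply/eqP/negPn/f0.
Qed.

Lemma dim_tensor_space : \dim {: tensor_space F d} = (\prod_(i < n) d i)%N.
Proof.
rewrite dimvf; have -> : dim (tensor_space F d) =
  (#|{: {dffun forall i : 'I_n, 'I_(d i)}}| * dim F^o)%N by [].
rewrite card_dep_ffun foldrE big_map big_enum /= -[RHS]muln1; congr (_ * _)%N.
by apply: eq_bigr => i _; rewrite card_ord.
Qed.
End Tensors.

(** * The upper bound, then the lower bound *)

Lemma hyperplane_has_product_basis (F : finFieldType) (n : nat)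
    (d : 'I_n -> nat) (L : {vspace tensor_space F d}) :
  (\prod_(i < n) d i <= (\dim L).+1)%N -> has_product_basis L.
Proof.
move=> dimL.
(* All product vectors of [L]: a finite list because [F] is finite. *)
pose X :=
  [seq t <- [seq tensor w | w : {dffun forall i, 'rV[F]_(d i)}] | t \in L].
have memX u : tensor u \in L -> tensor u \in X.
  move=> uL; rewrite mem_filter uL /=; apply/imageP.
  by exists (finfun u) => //; apply: eq_tensor => i; rewrite ffunE.
have [Y YX sYX] := span_basis_subseq X.
suff XL : <<X>>%VS = L.
  exists Y; first by rewrite -XL.
  by move=> v /sYX; rewrite mem_filter => /andP[_ /imageP[w _ ->]]; exists w.
have sXL : (<<X>> <= L)%VS.
  by apply/span_subvP => v; rewrite mem_filter => /andP[].
apply/eqP; rewrite eqEsubv sXL; apply/subvP => t tL; apply/negPn/negP => tX.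
have [g [Xg gt]] := separating_functional tX.
have [f Lf] : exists f : 'Hom(tensor_space F d, F^o), L = lker f.
  have [->|] := eqVneq L fullv.
    by exists 0; apply/vspaceP => v; rewrite memvf memv_ker lfun_simp eqxx.
  rewrite eqEsubv subvf => /subvPn[v _ vL].
  have [f [sLf fv]] := separating_functional vL; exists f.
  (* As [f v != 0], the kernel is a proper subspace, so its dimension is at most [\dim L]. *)
  apply/eqP; rewrite eqEdim sLf -ltnS (leq_trans _ dimL) // -(dim_tensor_space F).
  rewrite ltnNge; apply: contra fv => dimf; rewrite -memv_ker.
  have /eqP -> : lker f == fullv by rewrite eqEdim subvf dimf.
  exact: memvf.
have ker_fg u : f (tensor u) = 0 -> g (tensor u) = 0.
  move=> fu; apply/eqP; rewrite -memv_ker; apply: (subvP Xg); apply: memv_span.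
  by apply: memX; rewrite Lf memv_ker fu.
move/negP: gt; apply; apply/eqP/(functional_ker_sub ker_fg)/eqP.
by rewrite -memv_ker -Lf.
Qed.

Lemma no_product_basis_codim2 (F : fieldType) (n : nat) (d : 'I_n -> nat) :
    (2 <= n)%N -> (forall i, 2 <= d i)%N ->
  exists L : {vspace tensor_space F d},
    \dim L = (\prod_(i < n) d i - 2)%N /\ ~ has_product_basis L.
Proof.
move=> n2 d2; pose i0 := Ordinal (ltnW n2); pose i1 := Ordinal n2.
pose idx (S : pred 'I_n) : {dffun forall i, 'I_(d i)} :=
  [ffun i => if S i then Ordinal (d2 i) else Ordinal (ltnW (d2 i))].
have idx_neq i S T : S i != T i -> idx S != idx T.
  apply: contraNneq => ST.
  have := congr1 (fun j : {dffun forall i, 'I_(d i)} => val (j i)) ST.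
  by rewrite !ffunE; case: (S i) (T i) => [] [].
(* In the first two positions [a], [b], [c], [e] read 10, 00, 11, 01; elsewhere they are 0. *)
pose a := idx (pred1 i0); pose b := idx pred0.
pose c := idx (pred2 i0 i1); pose e := idx (pred1 i1).
have ab : a != b by exact: (idx_neq i0).
have ac : a != c by exact: (idx_neq i1).
have bc : b != c by exact: (idx_neq i0).
(* In each factor, [b] and [c] pick the same two entries as [a] and [e], up to order. *)
have swap u : tensor u b * tensor u c = tensor u a * tensor u e :> F.
  rewrite !ffunE -!big_split /=; apply: eq_bigr => i _; rewrite !ffunE /=.
  by case: eqVneq => [->|//]; rewrite mulrC.
pose phi (t : tensor_space F d) : F^o * F^o := (t a, t b - t c).
have phi_linear : linear phi.
  move=> k x y; rewrite /phi !ffunE; congr (_, _) => /=.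
  by rewrite scalerBr addrACA opprD.
pose phiL := GRing.isLinear.Build F (tensor_space F d) (F^o * F^o)%type *:%R
  phi phi_linear.
pose Phi : {linear _ -> _} := HB.pack phi phiL.
pose L := lker (linfun Phi).
have memL t : (t \in L) = (t a == 0) && (t b == t c).
  by rewrite memv_ker lfunE /= xpair_eqE subr_eq0.
exists L; split.
  (* Since [phi] maps onto a plane, rank-nullity gives its kernel codimension exactly 2. *)
  have surj : limg (linfun Phi) = fullv.
    apply/eqP; rewrite eqEsubv subvf; apply/subvP => -[x y] _.
    pose t : tensor_space F d :=
      [ffun j => if j == a then x else if j == b then y else 0].
    have -> : (x, y) = linfun Phi t.
      rewrite lfunE /= /phi !ffunE eqxx (eq_sym b a) (negPf ab) eqxx.
      by rewrite (eq_sym c a) (eq_sym c b) (negPf ac) (negPf bc) subr0.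
    exact: memv_img (memvf _).
  have := limg_ker_dim (linfun Phi) fullv.
  rewrite capfv surj dim_tensor_space => <-.
  by rewrite dimvf addnK.
case=> X XL Xprod.
have X_b t : t \in X -> t b = 0.
  move=> tX; have [u tu] := Xprod t tX.
  have /andP[/eqP ta /eqP tbc] : (t a == 0) && (t b == t c).
    by rewrite -memL (basis_mem XL).
  have := swap u; rewrite -tu ta mul0r -tbc => /eqP.
  by rewrite mulf_eq0 orbb => /eqP.
(* The sum of the unit tensors at [b] and [c] lies in [L], yet its entry at [b] is 1. *)
pose t : tensor_space F d := [ffun j => if (j == b) || (j == c) then 1 else 0].
have tL : t \in L by rewrite memL !ffunE !eqxx orbT (negPf ab) (negPf ac) !eqxx.
have /eqP : t b = 0.
  have tX : t \in <<X>>%VS by rewrite (span_basis XL).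
  rewrite (coord_span (X := in_tuple X) tX) sum_ffunE big1 // => i _.
  by rewrite ffunE X_b ?scaler0 // mem_nth.
by rewrite ffunE eqxx oner_eq0.
Qed.

Local Close Scope ring_scope.

Theorem theorem3p3 (F : finFieldType) (q : nat) (hq : #|F| = q)
    (n : nat) (hn : 2 <= n) (d : 'I_n -> nat) (hd : forall i : 'I_n, 2 <= d i)
    (hcond : n = 2 \/
       (3 <= n /\ exists n1 n2 : 'I_n,
          \max_(i < n | (i != n1) && (i != n2)) d i < q)) :
  is_max
    (fun k : nat => exists L : {vspace tensor_space F d},
       \dim L = k /\ ~ has_product_basis L)
    (\prod_(i < n) d i - 2).
Proof.
have [L [dimL noL]] := no_product_basis_codim2 F hn hd.
split; first by exists L.
move=> k [L' [<- noL']]; rewrite leqNgt; apply/negP => dimL'.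
apply: noL'; apply: hyperplane_has_product_basis.
(* With [\dim L' = m.+1], the truncated inequality becomes [\prod_(i < n) d i <= 2 + m], that is,
   codimension at most 1. *)
by case: (\dim L') dimL' => // m; rewrite ltnS leq_subLR.
Qed.
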